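(* Let $PG=G/Z$, with $\bar D=DZ$ and $\bar T=TZ$. Then $PG$ has the following presentation: generators $\bar D,\bar T$ and relations $$\bar D^8=1,\quad \bar T^2=1,\quad \bar T\bar D\bar T=\bar D^7\bar T\bar D^7,\quad \bar T\bar D^5\bar T=\bar D^3\bar T\bar D^3.$$ Further, each element of $PG$ can be written in exactly one of the following forms (i.e. is equal to exactly one of the words in the following list): $$\bar 1,\quad \bar D^{n_1},\quad \bar T,\quad \bar D^{n_1}\bar T,\quad \bar T\bar D^{n_2},\quad \bar D^{n_3}\bar T\bar D^{n_4},\quad \bar T\bar D^{e_1}\bar T,\quad \bar D^{n_5}\bar T\bar D^{e_2}\bar T,$$ where $n_1,\ldots,n_5\in\{1,2,\ldots,7\}$ and $e_1,e_2\in\{2,4,6\}$, the parameters in each form ranging independently over these sets.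
   Context: $G$ is the group (of order $384$) generated by the symbols $D$ and $T$ subject to the defining relations $D^8=1$, $T^8=1$, $T^2D=DT^2$, $TDT=D^7T^3D^7$, $TD^5T=D^3T^7D^3$. $Z$ denotes the center of $G$; one has $Z=\{1,T^2,T^4,T^6\}$. The symbol $\bar 1$ denotes the identity element of $PG$. *)

(* Defs.v *)
From HB Require Import structures.
From mathcomp Require Import all_boot all_fingroup all_solvable.

Set Implicit Arguments.
Unset Strict Implicit.
Unset Printing Implicit Defensive.

Local Open Scope group_scope.

Variant gen := GenD | GenT.

Definition bool_of_gen (a : gen) := if a is GenD then true else false.
Definition gen_of_bool (b : bool) := if b then GenD else GenT.
Lemma bool_of_genK : cancel bool_of_gen gen_of_bool.
Proof. by case. Qed.
HB.instance Definition _ := Countable.copy gen (can_type bool_of_genK).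

(* A letter [(a, true)] stands for the formal inverse of the generator [a];
   multiplication of words is concatenation. *)
Definition word := seq (gen * bool).

Definition D (n : nat) : word := nseq n (GenD, false).
Definition T (n : nat) : word := nseq n (GenT, false).

(* Equality in the abstract group < D, T | rels >, i.e. in the quotient of the
   free group on D and T by the normal closure of the u v^-1, (u, v) in rels. *)
Inductive pres_eq (rels : seq (word * word)) : word -> word -> Prop :=
  | pres_eq_rel u v : (u, v) \in rels -> pres_eq rels u v
  | pres_eq_inv a e : pres_eq rels [:: (a, e); (a, ~~ e)] [::]
  | pres_eq_cat u u' v v' :
      pres_eq rels u u' -> pres_eq rels v v' -> pres_eq rels (u ++ v) (u' ++ v')
  | pres_eq_refl u : pres_eq rels u u
  | pres_eq_sym u v : pres_eq rels u v -> pres_eq rels v u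
  | pres_eq_trans u v w :
      pres_eq rels u v -> pres_eq rels v w -> pres_eq rels u w.

Definition weval (gT : finGroupType) (d t : gT) (w : word) : gT :=
  \prod_(l <- w) let x := if l.1 is GenD then d else t in
                 if l.2 then x^-1 else x.

(* The evaluation D |-> d, T |-> t induces an isomorphism of < D, T | rels >
   onto A. The library's [A \isog Grp (x : y : ...)] is weaker: it identifies A
   only with the largest finite quotient of the presented group, and it does not
   say which elements of A the generators are. *)
Definition presented_by (gT : finGroupType) (A : {set gT}) (d t : gT)
    (rels : seq (word * word)) : Prop :=
  (forall g, g \in A <-> exists w, weval d t w = g) /\
  (forall u v, weval d t u = weval d t v <-> pres_eq rels u v).

Definition G_rels : seq (word * word) :=
  [:: (D 8, [::]);
      (T 8, [::]);
      (T 2 ++ D 1, D 1 ++ T 2);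
      (T 1 ++ D 1 ++ T 1, D 7 ++ T 3 ++ D 7);
      (T 1 ++ D 5 ++ T 1, D 3 ++ T 7 ++ D 3)].

Definition PG_rels : seq (word * word) :=
  [:: (D 8, [::]);
      (T 2, [::]);
      (T 1 ++ D 1 ++ T 1, D 7 ++ T 1 ++ D 7);
      (T 1 ++ D 5 ++ T 1, D 3 ++ T 1 ++ D 3)].

Definition n_range : seq nat := [:: 1; 2; 3; 4; 5; 6; 7]%N.
Definition e_range : seq nat := [:: 2; 4; 6]%N.

Definition normal_words : seq word :=
  [:: [::]]
  ++ [seq D n1 | n1 <- n_range]
  ++ [:: T 1]
  ++ [seq D n1 ++ T 1 | n1 <- n_range]
  ++ [seq T 1 ++ D n2 | n2 <- n_range]
  ++ [seq D n3 ++ T 1 ++ D n4 | n3 <- n_range, n4 <- n_range]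
  ++ [seq T 1 ++ D e1 ++ T 1 | e1 <- e_range]
  ++ [seq D n5 ++ T 1 ++ D e2 ++ T 1 | n5 <- n_range, e2 <- e_range].

(* Main.v *)
Require Import Defs.
From mathcomp Require Import all_boot all_fingroup all_solvable.
From Stdlib Require Import Setoid Morphisms.
From mathcomp Require Import zify.

(* The relations rewrite every word to one of the 96 listed words, and they hold
   in the group G(4,4,3) of 3x3 monomial matrices whose nonzero entries are
   4th roots of unity with product 1, where the 96 words take distinct values
   and only the identity is central. A word that is central in G is therefore
   trivial modulo the relations of PG, so Z(G) is exactly the normal closure
   of T^2. *)

Set Implicit Arguments.
Unset Strict Implicit.
Unset Printing Implicit Defensive.

#[local] Instance pres_eq_Equivalence rels : Equivalence (pres_eq rels).
Proof.
split; [exact: pres_eq_refl | exact: pres_eq_sym | exact: pres_eq_trans].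
Qed.

#[local] Hint Extern 0 (pres_eq _ _ _) => reflexivity : core.

#[local] Instance cat_pres_eq_Proper rels :
  Proper (pres_eq rels ==> pres_eq rels ==> pres_eq rels)
         (@cat (gen * bool)).
Proof. by move=> u u' eq_u v v' eq_v; apply: pres_eq_cat. Qed.

(** * Consequences of the relations of [PG] for words *)

Local Open Scope nat_scope.

Lemma D_add m n : D m ++ D n = D (m + n).
Proof. by rewrite /D nseqD. Qed.

Section Words.

Local Notation "u ~ v" := (pres_eq PG_rels u v) (at level 70).
Local Notation T1 := (T 1).

Lemma D8 : D 8 ~ [::].
Proof. by apply: pres_eq_rel; rewrite !inE eqxx. Qed.

Lemma T_T : T1 ++ T1 ~ [::].
Proof. exact: (@pres_eq_rel _ (T 2)). Qed.

Lemma T_T_cat w : T1 ++ T1 ++ w ~ w.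
Proof. by rewrite catA T_T. Qed.

Lemma D_mod n : D n ~ D (n %% 8).
Proof.
rewrite {1}(divn_eq n 8); elim: (n %/ 8)%N => [//|k IHk].
by rewrite mulSn -addnA -D_add D8.
Qed.

Lemma D_eqmod m n : m = n %[mod 8] -> D m ~ D n.
Proof. by move=> eq_mn; rewrite D_mod eq_mn -D_mod. Qed.

Lemma D_eq0 n : n %% 8 = 0%N -> D n ~ [::].
Proof. by move=> n0; rewrite (@D_eqmod n 0). Qed.

(** The exponent [7 * n] plays the role of -n modulo 8. The hypothesis gives T = D^n (T D^n T) D^n;
    substituted for the last T of T D^(-n) T, it lets D^(-n) D^n and then T T cancel. *)
Lemma TDT_inv n : T1 ++ D n ++ T1 ~ D (7 * n) ++ T1 ++ D (7 * n) ->
  T1 ++ D (7 * n) ++ T1 ~ D n ++ T1 ++ D n.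
Proof.
move=> TDnT.
have {2}-> : T1 ~ D n ++ (T1 ++ D n ++ T1) ++ D n.
  rewrite TDnT -!catA D_add catA D_add (@D_eq0 (n + _)); last lia.
  by rewrite (@D_eq0 (_ + n)) ?cats0 //; lia.
rewrite -!catA (catA (D (7 * n))) D_add (@D_eq0 (_ + n)); last lia.
by rewrite T_T_cat.
Qed.

(** The relations are the cases 1 and 5, since 7 * 5 = 3 modulo 8; [TDT_inv] derives from them the
    cases 7 and 3. *)
Lemma TDT_odd n : odd n -> T1 ++ D n ++ T1 ~ D (7 * n) ++ T1 ++ D (7 * n).
Proof.
have TDT1 : T1 ++ D 1 ++ T1 ~ D (7 * 1) ++ T1 ++ D (7 * 1).
  exact: pres_eq_rel.
have TDT5 : T1 ++ D 5 ++ T1 ~ D (7 * 5) ++ T1 ++ D (7 * 5).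
  by rewrite (@D_eqmod (7 * 5) 3) //; exact: pres_eq_rel.
have red m : m = n %[mod 8] ->
    T1 ++ D m ++ T1 ~ D (7 * m) ++ T1 ++ D (7 * m) ->
    T1 ++ D n ++ T1 ~ D (7 * n) ++ T1 ++ D (7 * n).
  by move=> mn; rewrite (D_eqmod mn) (@D_eqmod (7 * m) (7 * n)) //; lia.
move=> n_odd.
have [n1|[n3|[n5|n7]]] : n %% 8 = 1%N \/ n %% 8 = 3 \/ n %% 8 = 5 \/ n %% 8 = 7.
  by lia.
- exact: (red 1%N).
- apply: (red 3) => //; rewrite (@D_eqmod 3 (7 * 5)) // TDT_inv //.
  by rewrite (@D_eqmod (7 * 3) 5).
- exact: (red 5).
- apply: (red 7) => //; rewrite (@D_eqmod 7 (7 * 1)) // TDT_inv //.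
  by rewrite (@D_eqmod (7 * 7) 1).
Qed.

(* [T D^e T D = T D^e (T D T) T = T D^(e-1) T D^-1 T = D^(1-e) T D^-e T] *)
Lemma TDTD_even e : ~~ odd e ->
  T1 ++ D e ++ T1 ++ D 1 ~ D (7 * e + 1) ++ T1 ++ D (7 * e) ++ T1.
Proof.
move=> e_even.
have -> : T1 ++ D 1 ~ D 7 ++ T1 ++ D 7 ++ T1.
  by rewrite -{1}(cats0 (D 1)) -T_T (catA (D 1)) catA (TDT_odd (n := 1)).
rewrite (catA (D e)) D_add 2!catA -(catA T1) TDT_odd; last by lia.
rewrite -!catA (catA (D (7 * (e + 7))) (D 7)) D_add.
rewrite (@D_eqmod (7 * (e + 7)) (7 * e + 1)); last by lia.
by rewrite (@D_eqmod (7 * (e + 7) + 7) (7 * e)) //; lia.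
Qed.

(** Two uses of [TDTD_even], with e and then -e: the factors D^(1-e) and D^(1+e) combine to D^2. *)
Lemma TDTD2_even e : ~~ odd e ->
  T1 ++ D e ++ T1 ++ D 2 ~ D 2 ++ T1 ++ D e ++ T1.
Proof.
move=> e_even; rewrite -[D 2](D_add 1 1).
rewrite (catA T1 (D 1)) (catA (D e)) catA TDTD_even // -!catA TDTD_even; last by lia.
rewrite catA D_add (@D_eqmod (_ + _) 2); last by lia.
by rewrite (@D_eqmod (7 * (7 * e)) e) ?D_add //; lia.
Qed.

Lemma TDTD_even_even e b : ~~ odd e -> ~~ odd b ->
  T1 ++ D e ++ T1 ++ D b ~ D b ++ T1 ++ D e ++ T1.
Proof.
move=> e_even b_even; rewrite (_ : b = b./2.*2); last by lia.
elim: b./2 => [//|k IHk].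
rewrite doubleS -add2n -D_add (catA T1 (D 2)) (catA (D e)) catA TDTD2_even //.
by rewrite -!catA IHk.
Qed.

(** * Reduction of every word to a listed one *)

(** Exponents are unbounded and may vanish, which merges the eight listed shapes into three;
    [normal_form_normal_words] reduces them modulo 8. *)
Variant normal_form : word -> Prop :=
  | NF_D a : normal_form (D a)
  | NF_DTD a b : normal_form (D a ++ T1 ++ D b)
  | NF_DTDT a e : ~~ odd e -> normal_form (D a ++ T1 ++ D e ++ T1).

Lemma normal_form_D n u : normal_form u ->
  exists2 v, normal_form v & D n ++ u ~ v.
Proof.
case=> [a|a b|a e e_even].
- by exists (D (n + a)); [constructor | rewrite D_add].
- by exists (D (n + a) ++ T1 ++ D b); [constructor | rewrite catA D_add].
- by exists (D (n + a) ++ T1 ++ D e ++ T1); [constructor | rewrite catA D_add].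
Qed.

Lemma normal_form_T u : normal_form u -> exists2 v, normal_form v & T1 ++ u ~ v.
Proof.
case=> [a|a b|a e e_even].
- by exists (D 0 ++ T1 ++ D a); [constructor | reflexivity].
- have [a_odd|a_even] := boolP (odd a).
    exists (D (7 * a) ++ T1 ++ D (7 * a + b)); first by constructor.
    by rewrite (catA (D a)) catA TDT_odd // -!catA D_add.
  have [b_odd|b_even] := boolP (odd b); last first.
    exists (D b ++ T1 ++ D a ++ T1); first by constructor.
    exact: TDTD_even_even.
  (* Here a is even and b odd: D^(b-1) moves left across T D^a T, and [TDTD_even] absorbs the
     remaining D. *)
  exists (D (b.-1 + (7 * a + 1)) ++ T1 ++ D (7 * a) ++ T1).
    by constructor; lia.
  have -> : D b = D b.-1 ++ D 1 by rewrite D_add addn1 prednK ?odd_gt0.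
  rewrite (catA T1 (D b.-1)) (catA (D a)) catA TDTD_even_even //; last by lia.
  by rewrite -!catA TDTD_even // catA D_add.
- have [a_odd|a_even] := boolP (odd a).
    (* T D^a T becomes D^(-a) T D^(-a), which leaves T D^(e-a) T with e - a odd, so the same rule
       applies again. *)
    exists (D (7 * a + 7 * (7 * a + e)) ++ T1 ++ D (7 * (7 * a + e))).
      by constructor.
    rewrite (catA (D a)) catA TDT_odd // -!catA (catA (D (7 * a)) (D e)) D_add.
    by rewrite TDT_odd; [rewrite catA D_add | lia].
  (* D^e moves left across T D^a T, and the two final T cancel. *)
  exists (D e ++ T1 ++ D a); first by constructor.
  rewrite (catA T1 (D e)) (catA (D a)) catA TDTD_even_even // -!catA T_T.
  by rewrite cats0.
Qed.

Lemma letter_DV : [:: (GenD, true)] ~ D 7.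
Proof.
transitivity ([:: (GenD, true)] ++ D 8); first by rewrite D8.
exact: pres_eq_cat (pres_eq_inv _ GenD true) (pres_eq_refl _ (D 7)).
Qed.

Lemma letter_TV : [:: (GenT, true)] ~ T1.
Proof.
transitivity ([:: (GenT, true)] ++ T1 ++ T1); first by rewrite T_T.
exact: pres_eq_cat (pres_eq_inv _ GenT true) (pres_eq_refl _ (T1)).
Qed.

Lemma reduce w : exists2 u, normal_form u & w ~ u.
Proof.
elim: w => [|l w [u nf_u w_u]]; first by exists (D 0); first exact: NF_D.
have -> : l :: w = [:: l] ++ w by [].
case: l => [[] []].
- have [v nf_v u_v] := normal_form_D 7 nf_u.
  by exists v => //; rewrite letter_DV w_u.
- have [v nf_v u_v] := normal_form_D 1 nf_u.
  by exists v => //; rewrite w_u.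
- have [v nf_v u_v] := normal_form_T nf_u.
  by exists v => //; rewrite letter_TV w_u.
- have [v nf_v u_v] := normal_form_T nf_u.
  by exists v => //; rewrite w_u.
Qed.

Lemma normal_form_normal_words u : normal_form u ->
  exists2 n, n \in normal_words & u ~ n.
Proof.
(* Membership for a residue modulo 8 becomes a finite check, settled by computation. *)
have mem8 (P : pred nat) n : all P (iota 0 8) -> P (n %% 8).
  by move/allP; apply; rewrite mem_iota; lia.
case=> [a|a b|a e e_even].
- exists (D (a %% 8)); last exact: D_mod.
  by apply: (mem8 (fun a => D a \in normal_words)); vm_compute.
- exists (D (a %% 8) ++ T1 ++ D (b %% 8)); last by rewrite (D_mod a) (D_mod b).
  apply: (mem8 (fun b => _ ++ _ ++ D b \in _)).
  apply: (mem8 (fun a => all (fun b => D a ++ T1 ++ D b \in _) _)).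
  by vm_compute.
(* The list has no e = 0: in that case D^a T D^e T collapses to D^a. *)
- have [e0|e_neq0] := eqVneq (e %% 8) 0.
    exists (D (a %% 8)).
      by apply: (mem8 (fun a => D a \in normal_words)); vm_compute.
    by rewrite (D_eq0 e0) T_T cats0 -D_mod.
  exists (D (a %% 8) ++ T1 ++ D (e %% 8) ++ T1).
    move: e_neq0; apply/implyP; have: ~~ odd (e %% 8) by lia.
    apply/implyP.
    apply: (mem8 (fun e => ~~ odd e ==> (e != 0) ==>
      (_ ++ _ ++ D e ++ _ \in _))).
    apply: (mem8 (fun a => all (fun e => ~~ odd e ==> (e != 0) ==>
      (D a ++ T1 ++ D e ++ T1 \in _)) _)).
    by vm_compute.
  by rewrite (D_mod a) (D_mod e).
Qed.

Lemma exists_normal_word w : exists2 n, n \in normal_words & w ~ n.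
Proof.
have [u /normal_form_normal_words [n n_in u_n] w_u] := reduce w.
by exists n => //; rewrite w_u.
Qed.

(** * The monomial model that separates the listed words *)

(* The point 4 j + k stands for i^k e_j (j < 3, k < 4). D exchanges the lines of
   e_0 and e_1, with coefficients i and 1, and multiplies e_2 by -i; T exchanges
   e_1 and e_2. Numbers >= 12 are fixed, which makes all the actions total. *)
Definition monomial_table (l : gen * bool) : seq nat :=
  match l with
  | (GenD, false) => [:: 5; 6; 7; 4; 0; 1; 2; 3; 11; 8; 9; 10]
  | (GenD, true) => [:: 4; 5; 6; 7; 3; 0; 1; 2; 9; 10; 11; 8]
  | (GenT, _) => [:: 0; 1; 2; 3; 8; 9; 10; 11; 4; 5; 6; 7]
  end.

Definition monomial_act (w : word) (i : nat) : nat :=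
  foldl (fun j l => nth j (monomial_table l) j) i w.

Definition monomial_graph (w : word) : seq nat :=
  [seq monomial_act w i | i <- iota 0 12].

Lemma monomial_act_pres_eq u v : u ~ v -> monomial_act u =1 monomial_act v.
Proof.
elim=> {u v} [u v uv|a e|u u' v v' _ IHu _ IHv|u|u v _ IH|u v w _ IHu _ IHv] i //.
- move: uv; rewrite !inE => /or4P[] /eqP[-> ->].
  (* Twelve splits enumerate the points; the thirteenth lets [nth] past the end of the table reduce
     to its default, the point itself. *)
  1-4: by do 13! [case: i => [//|i]].
- by case: a e => [] []; do 13! [case: i => [//|i]].
- by rewrite /monomial_act !foldl_cat -!/(monomial_act _ _) IHu IHv.
- by rewrite IHu IHv.
Qed.

Lemma pres_eq_monomial_graph u v : u ~ v -> monomial_graph u = monomial_graph v.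
Proof. by move/monomial_act_pres_eq=> uv; apply: eq_map. Qed.

Lemma uniq_graph_normal_words : uniq (map monomial_graph normal_words).
Proof. by vm_compute. Qed.

Lemma pres_eq_normal_words u v : u \in normal_words -> v \in normal_words ->
  u ~ v -> u = v.
Proof.
move=> u_in v_in /pres_eq_monomial_graph eq_uv.
set s := normal_words in u_in v_in *; set gs := map monomial_graph s.
(* The graphs are pairwise distinct, so equal graphs force equal positions in the list. *)
have: nth [::] gs (index u s) == nth [::] gs (index v s).
  by rewrite !(nth_map [::]) ?index_mem // !nth_index // eq_uv.
rewrite nth_uniq ?size_map ?index_mem ?uniq_graph_normal_words // => /eqP eq_i.
by rewrite -(nth_index [::] u_in) eq_i nth_index.
Qed.

Lemma central_word_trivial w :
  w ++ D 1 ~ D 1 ++ w -> w ++ T1 ~ T1 ++ w -> w ~ [::].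
Proof.
have [n n_in w_n] := exists_normal_word w.
rewrite w_n => /pres_eq_monomial_graph /eqP nD /pres_eq_monomial_graph /eqP nT.
suff /eqP-> : n == [::] by [].
have /allP/(_ n n_in) : all (fun n => (monomial_graph (n ++ D 1) ==
    monomial_graph (D 1 ++ n)) ==> (monomial_graph (n ++ T1) ==
    monomial_graph (T1 ++ n)) ==> (n == [::])) normal_words by vm_compute.
by rewrite nD nT.
Qed.

(** Modulo T^2 = 1, powers of T depend only on the parity of the exponent, which turns the relations
    of [G] into those of [PG] or into trivial ones. *)
Lemma G_rels_PG_rels u v : pres_eq G_rels u v -> u ~ v.
Proof.
have T_mod n : T n.+2 ~ T n.
  by rewrite -addn2 /T nseqD (T_T : nseq 2 _ ~ _) cats0.
elim=> {u v} [u v uv|a e|u u' v v' _ IHu _ IHv|//|u v _ IH|u v w _ IHu _ IHv].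
- move: uv; rewrite !inE => /orP[|/or4P[]] /eqP[-> ->].
  + exact: D8.
  + by rewrite -[X in X ~ _]/(T 8) (T_mod 6) (T_mod 4) (T_mod 2) (T_mod 0).
  + rewrite -[X in X ~ _]/(T 2 ++ D 1) -[X in _ ~ X]/(D 1 ++ T 2).
    by rewrite (T_mod 0) cats0.
  + rewrite -[X in _ ~ X]/(D 7 ++ T 3 ++ D 7) (T_mod 1).
    exact: pres_eq_rel.
  + rewrite -[X in _ ~ X]/(D 3 ++ T 7 ++ D 3) (T_mod 5) (T_mod 3) (T_mod 1).
    exact: pres_eq_rel.
- exact: pres_eq_inv.
- exact: pres_eq_cat.
- by symmetry.
- by rewrite IHu.
Qed.

End Words.

(** * Evaluation of words in finite groups *)

Local Open Scope group_scope.

Lemma weval_cat (gT : finGroupType) (d t : gT) u v :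
  weval d t (u ++ v) = weval d t u * weval d t v.
Proof. by rewrite /weval big_cat. Qed.

Lemma weval_D1 (gT : finGroupType) (d t : gT) : weval d t (D 1) = d.
Proof. by rewrite /weval big_seq1. Qed.

Lemma weval_T1 (gT : finGroupType) (d t : gT) : weval d t (T 1) = t.
Proof. by rewrite /weval big_seq1. Qed.

Lemma weval_mem (gT : finGroupType) (A : {group gT}) (d t : gT) w :
  d \in A -> t \in A -> weval d t w \in A.
Proof.
move=> dA tA; rewrite /weval; elim/big_rec: _ => [|[[] []] g _ gA] /=.
all: by rewrite ?group1 // groupM ?groupV.
Qed.

Lemma weval_morph (aT rT : finGroupType) (A : {group aT})
    (f : {morphism A >-> rT}) d t w :
  d \in A -> t \in A -> f (weval d t w) = weval (f d) (f t) w.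
Proof.
move=> dA tA; elim: w => [|l w IHw]; first by rewrite /weval !big_nil morph1.
rewrite -cat1s !weval_cat morphM ?weval_mem // IHw /weval !big_seq1.
by case: l => [[] []] /=; rewrite ?morphV.
Qed.

(** Von Dyck's theorem: elements that satisfy the relations satisfy all their consequences. *)
Lemma weval_pres_eq (gT : finGroupType) (d t : gT) rels u v :
  (forall u v, (u, v) \in rels -> weval d t u = weval d t v) ->
  pres_eq rels u v -> weval d t u = weval d t v.
Proof.
move=> rels_ok; elim=> {u v} [u v /rels_ok //|a e|u u' v v' _ IHu _ IHv|//|//|].
- rewrite /weval !big_cons !big_nil mulg1.
  by case: e => /=; rewrite ?mulVg ?mulgV.
- by rewrite !weval_cat IHu IHv.
- by move=> u v w _ -> _ ->.
Qed.

Theorem theorem3p1 (gT : finGroupType) (G : {group gT}) (d t : gT)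
    (hG : presented_by G d t G_rels) :
  let dbar := coset 'Z(G) d in
  let tbar := coset 'Z(G) t in
  presented_by (G / 'Z(G)) dbar tbar PG_rels
  /\ (forall g : coset_of 'Z(G), g \in G / 'Z(G) ->
        count (fun w => weval dbar tbar w == g) normal_words = 1%N).
Proof.
move=> dbar tbar; have [gen_G rel_G] := hG.
have weval_G w : weval d t w \in G by apply/gen_G; exists w.
have dG : d \in G by rewrite -(weval_D1 d t).
have tG : t \in G by rewrite -(weval_T1 d t).
have nZG : G \subset 'N('Z(G)) := normal_norm (center_normal G).
have weval_bar w : weval dbar tbar w = coset 'Z(G) (weval d t w).
  by rewrite (weval_morph (coset_morphism 'Z(G))) ?(subsetP nZG).
have G_rel u v : (u, v) \in G_rels -> weval dbar tbar u = weval dbar tbar v.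
  by move=> uv; rewrite !weval_bar; congr coset; apply/rel_G/pres_eq_rel.
have T2Z : weval dbar tbar (T 2) = 1.
  rewrite weval_bar coset_id //; apply/centerP; split=> // g /gen_G[w <-].
  (* The elements commuting with t^2 form a subgroup, so it is enough that d and t belong to it. *)
  have com u v : pres_eq G_rels (u ++ v) (v ++ u) ->
      weval d t v \in 'C[weval d t u].
    by move=> uv; apply/cent1P; rewrite /commute -!weval_cat; apply/rel_G; symmetry.
  apply/commute_sym/cent1P/weval_mem.
    by rewrite -[X in X \in _](weval_D1 d t) com //; apply: pres_eq_rel.
  by rewrite -[X in X \in _](weval_T1 d t) com.
have PG_eq u v : weval dbar tbar u = weval dbar tbar v <-> pres_eq PG_rels u v.
  split=> [|]; last first.
    apply: weval_pres_eq => {u v} u v; rewrite !inE.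
    (* Since T^2 evaluates to 1, the exponents 3 and 7 of T in the relations of [G] can be lowered
       to 1. *)
    have T_mod n : weval dbar tbar (T n.+2) = weval dbar tbar (T n).
      by rewrite -addn2 /T nseqD weval_cat T2Z mulg1.
    case/or4P=> /eqP[-> ->].
    - exact: G_rel.
    - by rewrite T2Z /weval big_nil.
    - rewrite (G_rel _ (D 7 ++ T 3 ++ D 7)) //.
      rewrite -[RHS]/(weval _ _ (D 7 ++ T 1 ++ D 7)) !weval_cat.
      by rewrite (T_mod 1%N).
    - rewrite (G_rel _ (D 3 ++ T 7 ++ D 3)) //.
      rewrite -[RHS]/(weval _ _ (D 3 ++ T 1 ++ D 3)) !weval_cat.
      by rewrite (T_mod 5) (T_mod 3) (T_mod 1%N).
  (* Equal cosets mean that the value of u is z times that of v with z central; a word w for z is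
     trivial modulo [PG_rels] by [central_word_trivial], hence u and v agree there. *)
  rewrite !weval_bar => /rcoset_kercosetP.
  case/(_ (subsetP nZG _ (weval_G u)) (subsetP nZG _ (weval_G v)))/rcosetP=> z.
  case/centerP=> /gen_G[w <-] w_central.
  rewrite -weval_cat => /rel_G/G_rels_PG_rels ->.
  suff -> : pres_eq PG_rels w [::] by [].
  by apply: central_word_trivial; apply/G_rels_PG_rels/rel_G;
    rewrite !weval_cat w_central.
split.
  split=> // g; split=> [/morphimP[x _ /gen_G[w <-] ->]|[w <-]].
    by exists w; rewrite weval_bar.
  by rewrite weval_bar mem_quotient.
move=> g /morphimP[x _ /gen_G[w <-] g_w].
have {g_w}-> : g = weval dbar tbar w by rewrite g_w weval_bar.
have [n n_in /PG_eq ->] := exists_normal_word w.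
(* A listed word has value g only if it is n, and n occurs once in the list. *)
rewrite (@eq_in_count _ _ (pred1 n)).
  by rewrite count_uniq_mem ?n_in // (map_uniq uniq_graph_normal_words).
move=> v v_in /=; apply/eqP/eqP=> [/PG_eq|-> //].
exact: pres_eq_normal_words.
Qed.
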